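(* There is a universal constant $C$ such that the following holds. Given any $\epsilon>0$ and any nonzero integer $\lambda$, for all sufficiently large primes $p$ there exists a set $A\subset\mathbb{Z}/p\mathbb{Z}$ with $|A|\ge(1/2-\epsilon)p$ such that $|A+\lambda A|\le\big(1-\epsilon^{C\epsilon^{-1}}\big)p$.
   Context: For subsets $A,B$ of $\mathbb{Z}/p\mathbb{Z}$, $A+B=\{a+b: a\in A,\ b\in B\}$ and $\lambda A=\{\lambda a: a\in A\}$.
   Formalization: The formal statement takes 0 < ε ≤ 1 instead of any ε > 0: a valid C must be positive, and then for ε > 1 the bound (1 − ε^{C/ε})p is negative, so no set A can satisfy it. *)

(* Defs.v *)
From HB Require Import structures.
From mathcomp Require Import all_boot all_order all_algebra.
From mathcomp Require Import reals exp.

Set Implicit Arguments.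
Unset Strict Implicit.
Unset Printing Implicit Defensive.

Import GRing.Theory.

Local Open Scope ring_scope.

Definition sumset (G : finZmodType) (A B : {set G}) : {set G} :=
  [set a + b | a in A, b in B].

Definition dilate (G : finZmodType) (lambda : int) (A : {set G}) : {set G} :=
  [set a *~ lambda | a in A].

(* Main.v *)
Require Import Defs.
From HB Require Import structures.
From mathcomp Require Import all_boot all_order all_fingroup all_algebra.
From mathcomp Require Import reals exp.
From mathcomp Require Import zify lra.

(* Write u = -lambda, cut Z/p into boxes and order the boxes at random.  For an
   odd k, let A be the set of x such that the orbit x, u x, ..., u^k x stays
   away from the box borders and such that the index at which the orbit meets
   its least box is even and different from 0 and k.  If a = b + u a' and every
   u^j b with j < k is close to 0, then the orbit of a runs through the boxes of
   the orbit of a' moved by one place, so a and a' are not both in A: the set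
   A + lambda A avoids the whole Bohr set of such b, which has density at least
   (w/2)^k by the pigeonhole principle, if close to 0 means within w p.  When
   |lambda| > 1 and p is large, almost every orbit meets k + 1 distinct boxes,
   and then all k + 1 positions of the least box are equally likely; so some
   order gives A a density of at least 1/2 - O(1/k), with k of order 1/eps and w
   polynomial in eps.  When lambda = 1 or -1 an interval does. *)

Set Implicit Arguments.
Unset Strict Implicit.
Unset Printing Implicit Defensive.

Import Order.TTheory GRing.Theory Num.Theory.

(** * Strict minima under a random order *)

Definition strict_argmin (I : finType) (f : I -> nat) (i : I) : bool :=
  [forall j, (j != i) ==> (f i < f j)].

Lemma strict_argminP (I : finType) (f : I -> nat) (i : I) :
  reflect (forall j, j != i -> f i < f j) (strict_argmin f i).
Proof.
by apply: (iffP forallP) => H j; [move=> ji; have /implyP := H j; apply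
  | apply/implyP; exact: H].
Qed.

Lemma strict_argmin_uniq (I : finType) (f : I -> nat) (i j : I) :
  strict_argmin f i -> strict_argmin f j -> i = j.
Proof.
move=> /strict_argminP Hi /strict_argminP Hj; apply/eqP/negP => /negP ij.
have ji : j != i by rewrite eq_sym.
by have := ltn_trans (Hi j ji) (Hj i ij); rewrite ltnn.
Qed.

Lemma inj_strict_argmin (I : finType) (f : I -> nat) (i0 : I) :
  injective f -> exists i, strict_argmin f i.
Proof.
move=> finj; case: (@arg_minnP _ i0 xpredT f) => // i _ Hi.
exists i; apply/strict_argminP => j ji; rewrite ltn_neqAle Hi // andbT.
by apply: contra ji => /eqP/finj ->.
Qed.

Section RandomOrder.
Variables (N : nat) (I : finType) (c : I -> 'I_N).
Hypothesis c_inj : injective c.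

Let argmin_perms (i : I) : {set {perm 'I_N}} :=
  [set s : {perm 'I_N} | strict_argmin (fun j => s (c j) : nat) i].

Let argmin_perms_disjoint (i j : I) :
  i != j -> [disjoint argmin_perms i & argmin_perms j].
Proof.
move=> ij; rewrite -setI_eq0; apply/eqP/setP => s; rewrite !inE.
apply/negP => /andP[Hi Hj]; move: ij.
by rewrite (strict_argmin_uniq Hi Hj) eqxx.
Qed.

Let card_bigcup_argmin_perms (P : pred I) :
  #|\bigcup_(i | P i) argmin_perms i| = \sum_(i | P i) #|argmin_perms i|.
Proof.
rewrite big_mkcond /= -sum1_card partition_disjoint_bigcup => [|i j ij].
  rewrite [RHS]big_mkcond; apply: eq_bigr => i _.
  by rewrite sum1_card; case: (P i); rewrite ?cards0.
case: (P i); case: (P j); rewrite -setI_eq0 ?set0I ?setI0 //.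
by rewrite setI_eq0 argmin_perms_disjoint.
Qed.

(** Precomposing with the transposition of [c i] and [c j] exchanges the ranks of these two boxes
    and fixes the others, so it maps [argmin_perms i] injectively into [argmin_perms j]. *)
Let leq_argmin_perms (i j : I) : #|argmin_perms i| <= #|argmin_perms j|.
Proof.
pose t := tperm (c i) (c j).
rewrite -(card_imset _ (mulgI t)); apply: subset_leq_card.
apply/subsetP => _ /imsetP[s + ->]; rewrite !inE => /strict_argminP Hi.
apply/strict_argminP => l lj; rewrite !permM /t tpermR.
have [li|li] := eqVneq l i.
  by rewrite li tpermL; apply: Hi; rewrite -li eq_sym.
by rewrite tpermD ?(inj_eq c_inj) 1?eq_sym //; apply: Hi.
Qed.

Let card_argmin_perms (i : I) : #|argmin_perms i| * #|I| = N`!.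
Proof.
have -> : N`! = #|\bigcup_(j | xpredT j) argmin_perms j|.
  rewrite -card_Sn; apply: eq_card => s; rewrite inE; symmetry.
  have [j Hj] : exists j, strict_argmin (fun l => s (c l) : nat) j.
    by apply: inj_strict_argmin i _ => j l /val_inj/perm_inj/c_inj.
  by apply/bigcupP; exists j; rewrite ?inE.
rewrite card_bigcup_argmin_perms (eq_bigr (fun=> #|argmin_perms i|)).
  by rewrite sum_nat_const mulnC.
by move=> j _; apply/eqP; rewrite eqn_leq !leq_argmin_perms.
Qed.

(** By symmetry the argmin is uniform on [I]: it lies in [P] with probability |P|/|I|, here cleared
    of denominators. *)
Lemma card_argmin_perms_in (P : pred I) :
  #|[set s : {perm 'I_N} |
      [exists i, P i && strict_argmin (fun j => s (c j) : nat) i]]|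
    * #|I| = #|P| * N`!.
Proof.
have -> : [set s : {perm 'I_N} |
    [exists i, P i && strict_argmin (fun j => s (c j) : nat) i]] =
  \bigcup_(i | P i) argmin_perms i.
  apply/setP => s; rewrite !inE; apply/existsP/bigcupP.
    by case=> i /andP[Pi Hi]; exists i; rewrite ?inE.
  by case=> i Pi; rewrite inE => Hi; exists i; rewrite Pi.
rewrite card_bigcup_argmin_perms big_distrl /=.
under eq_bigr do rewrite card_argmin_perms.
by rewrite sum_nat_const.
Qed.
End RandomOrder.

(** * Finite counting *)

(** The indices 2, 4, ..., 2m qualify; a uniform argmin is thus admissible with probability at least
    m/(2m+2), close to 1/2. *)
Lemma card_even_inner (m : nat) :
  m <= #|[pred i : 'I_m.*2.+2 | [&& 0 < i, i < m.*2.+1 & ~~ odd i]]|.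
Proof.
pose f (t : 'I_m) : 'I_m.*2.+2 := inord t.*2.+2.
have fE t : f t = t.*2.+2 :> nat by rewrite inordK //; have := ltn_ord t; lia.
have f_inj : injective f.
  by move=> t t' /(congr1 val); rewrite /= !fE => H; apply: val_inj => /=; lia.
rewrite -[X in X <= _]card_ord -(card_codom f_inj); apply: subset_leq_card.
apply/subsetP => _ /codomP[t ->]; rewrite inE fE; have := ltn_ord t.
by rewrite /= odd_double; lia.
Qed.

Lemma pigeonhole_fiber (S T : finType) (f : S -> T) (x0 : S) :
  exists x, #|S| <= #|T| * #|[set y | f y == f x]|.
Proof.
have -> : #|S| = \sum_(v : T) #|[set y | f y == v]|.
  rewrite -sum1_card (partition_big f xpredT) //=.
  by apply: eq_bigr => v _; rewrite -sum1dep_card.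
case: (@arg_maxnP _ x0 xpredT (fun x => #|[set y | f y == f x]|)) => // x _ Hx.
exists x; rewrite -sum_nat_const; apply: leq_sum => v _.
have [->|/set0Pn[y]] := eqVneq [set y | f y == v] set0; first by rewrite cards0.
by rewrite inE => /eqP <-; apply: Hx.
Qed.

Lemma leq_card_bigcup (I T : finType) (P : pred I) (A : I -> {set T}) :
  #|\bigcup_(i | P i) A i| <= \sum_(i | P i) #|A i|.
Proof.
elim/big_ind2: _ => [|U a V b Ua Vb|//]; first by rewrite cards0.
by rewrite (leq_trans (leq_card_setU _ _)) // leq_add.
Qed.

Local Open Scope ring_scope.

(** * The marker set in a finite commutative ring *)

Section MarkerSet.
Variables (G : finComUnitRingType) (N k : nat) (cell : G -> 'I_N).
Variables (F : {set G}) (u : G).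

(** Excluding the indices 0 and [k] leaves room for the argmin to move by one place either way
    within the window; the parity condition detects such a move. *)
Definition marker_set (s : {perm 'I_N}) : {set G} :=
  [set x | [forall j : 'I_k.+1, u ^+ j * x \in F] &&
    [exists i : 'I_k.+1, [&& (0 < i)%N, (i < k)%N & ~~ odd i] &&
      strict_argmin (fun j : 'I_k.+1 => s (cell (u ^+ j * x)) : nat) i]].

(* The cells of the orbit of [b + u x] are those of the orbit of [x] moved one
   place, hence so is the argmin, and its parity changes. *)
Lemma marker_set_shift (S : {set G}) (s : {perm 'I_N}) (x b : G) :
  (forall y c, y \in F -> c \in S -> cell (y + c) = cell y) ->
  (forall j : 'I_k, u ^+ j * b \in S) ->
  x \in marker_set s -> b + u * x \notin marker_set s.
Proof.
move=> Fcell bS; rewrite !inE => /andP[/forallP xF /existsP[i]].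
case/andP=> /and3P[i0 ik iodd] /strict_argminP Hi.
apply/negP => /andP[_ /existsP[i' /andP[/and3P[i'0 i'k i'odd]]]].
move/strict_argminP=> Hi'.
have cellE (j : 'I_k.+1) (l : 'I_k.+1) : l = j.+1 :> nat ->
    cell (u ^+ j * (b + u * x)) = cell (u ^+ l * x).
  move=> lj; rewrite mulrDr mulrA -exprSr -lj addrC.
  apply: Fcell => //; have jk : (j < k)%N by rewrite -ltnS -lj ltn_ord.
  exact: (bS (Ordinal jk)).
(* In the orbit of [x], index [i] beats [i'.+1]; in that of [b + u * x], index [i'] beats [i.-1]. By
   [cellE] these are opposite inequalities between the same two ranks; parity excludes
   [i' = i.-1]. *)
pose a : 'I_k.+1 := inord i.-1.
pose a' : 'I_k.+1 := inord i'.+1.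
have aE : a = i.-1 :> nat by rewrite inordK //; have := ltn_ord i; lia.
have a'E : a' = i'.+1 :> nat by rewrite inordK //; lia.
have ai' : a != i'.
  apply/eqP => ai; move: aE iodd i'odd; rewrite ai => ->.
  by case: (nat_of_ord i) i0 => // n _ /=; case: odd.
have a'i : a' != i.
  apply: contra ai' => /eqP a'i.
  by apply/eqP/val_inj; rewrite /= aE -a'i a'E.
have := Hi _ a'i; have := Hi' _ ai'.
rewrite (cellE a i) ?(cellE i' a') //; last by lia.
by move=> /ltn_trans H /H; rewrite ltnn.
Qed.

Lemma card_mulr_preim (v : G) (D : {set G}) :
  v \is a GRing.unit -> #|[set x | v * x \in D]| = #|D|.
Proof.
move=> vU; rewrite -(card_imset _ (mulrI vU)); apply: eq_card => y.
apply/imsetP/idP => [[x + ->]|yD]; first by rewrite inE.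
by exists (v^-1 * y); rewrite ?inE mulVKr.
Qed.

(** The points to which [card_argmin_perms_in] applies: their orbit meets distinct boxes. *)
Definition marker_good : {set G} :=
  [set x | [forall j : 'I_k.+1, u ^+ j * x \in F] &&
    injectiveb (fun j : 'I_k.+1 => cell (u ^+ j * x))].

(** Union bound. Each bad event is the preimage of [~: F] or [D] under multiplication by a unit,
    [u ^+ j] or [u ^+ j - u ^+ i], hence has the same size. *)
Lemma card_marker_good (D : {set G}) :
  (forall y z, cell y = cell z -> y - z \in D) ->
  u \is a GRing.unit ->
  (forall i j : nat, (i < j <= k)%N -> u ^+ j - u ^+ i \is a GRing.unit) ->
  (#|G| <= #|marker_good| + k.+1 * #|~: F| + k.+1 ^ 2 * #|D|)%N.
Proof.
move=> cellD uU duU.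
pose B1 := \bigcup_(j : 'I_k.+1) [set x | u ^+ j * x \in ~: F].
pose B2 := \bigcup_(ij : 'I_k.+1 * 'I_k.+1 | (ij.1 < ij.2)%N)
  [set x | (u ^+ ij.2 - u ^+ ij.1) * x \in D].
have H1 : (#|B1| <= k.+1 * #|~: F|)%N.
  apply: leq_trans (leq_card_bigcup _ _) _.
  rewrite (eq_bigr (fun=> #|~: F|)) => [|j _]; last first.
    by rewrite card_mulr_preim ?unitrX.
  by rewrite sum_nat_const card_ord.
have H2 : (#|B2| <= k.+1 ^ 2 * #|D|)%N.
  apply: leq_trans (leq_card_bigcup _ _) _.
  rewrite (eq_bigr (fun=> #|D|)) => [|[i j] /= ij]; last first.
    by rewrite card_mulr_preim // duU // ij -ltnS ltn_ord.
  rewrite sum_nat_const leq_mul2r; apply/orP; right.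
  by apply: leq_trans (max_card _) _; rewrite card_prod card_ord mulnn.
have sub : [set: G] \subset marker_good :|: B1 :|: B2.
  apply/subsetP => x _; rewrite !inE.
  have [/forallP xF|] := boolP [forall j : 'I_k.+1, u ^+ j * x \in F]; last first.
    rewrite negb_forall => /existsP[j xF]; apply/orP; left; apply/orP; right.
    by apply/bigcupP; exists j; rewrite // !inE.
  have [//|/injectivePn[i [j ij cij]]] :=
    boolP (injectiveb (fun j : 'I_k.+1 => cell (u ^+ j * x))).
  rewrite /=; apply/orP; right; apply/bigcupP.
  have := ij; rewrite -val_eqE neq_ltn => /orP[lt|lt].
    by exists (i, j) => //=; rewrite inE mulrBl; apply: cellD.
  by exists (j, i) => //=; rewrite inE mulrBl; apply: cellD.
rewrite -cardsT (leq_trans (subset_leq_card sub)) //.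
rewrite (leq_trans (leq_card_setU _ _)) // leq_add //.
by rewrite (leq_trans (leq_card_setU _ _)) // leq_add.
Qed.
End MarkerSet.

(** First moment method: the best order does at least as well as the average, and each good point
    lies in [A t] for a proportion at least m/(2m+2) of the orders [t]. *)
Lemma exists_large_marker_set (G : finComUnitRingType) (N m : nat)
    (cell : G -> 'I_N) (F : {set G}) (u : G) :
  exists s : {perm 'I_N},
    (m * #|marker_good m.*2.+1 cell F u| <=
       m.*2.+2 * #|marker_set m.*2.+1 cell F u s|)%N.
Proof.
set A := marker_set _ _ _ _; set Gd := marker_good _ _ _ _.
case: (@arg_maxnP _ (1%g : {perm 'I_N}) xpredT (fun s => #|A s|)) => // s _ Hs.
exists s; rewrite -(leq_pmul2r (fact_gt0 N)).
have -> : (m.*2.+2 * #|A s| * N`! = m.*2.+2 * \sum_(t : {perm 'I_N}) #|A s|)%N.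
  by rewrite sum_nat_const card_Sn; lia.
apply: (@leq_trans (m.*2.+2 * \sum_(t : {perm 'I_N}) #|A t|)); last first.
  by rewrite leq_mul2l; apply/orP; right; apply: leq_sum => t _; apply: Hs.
(* Double counting of the pairs of an order [t] and a point of [A t]. *)
have -> : (\sum_(t : {perm 'I_N}) #|A t| = \sum_(x : G) #|[set t | x \in A t]|)%N.
  under eq_bigr do rewrite -sum1_card big_mkcond.
  rewrite exchange_big; apply: eq_bigr => x _.
  by rewrite -big_mkcond -sum1dep_card.
rewrite (bigID (mem Gd)) /= mulnDr (leq_trans _ (leq_addr _ _)) //.
rewrite -mulnA mulnCA -sum_nat_const big_distrr /=; apply: leq_sum => x.
rewrite inE => /andP[xF /injectiveP xinj].
have := card_argmin_perms_in xinj
  [pred i : 'I_m.*2.+2 | [&& (0 < i)%N, (i < m.*2.+1)%N & ~~ odd i]].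
rewrite card_ord => H.
apply: leq_trans (leq_mul (card_even_inner m) (leqnn _)) _.
rewrite -H mulnC leq_mul2l; apply/orP; right; apply: subset_leq_card.
by apply/subsetP => t; rewrite !inE xF.
Qed.

(** * Boxes and Bohr sets in a cyclic group *)

Section CyclicBoxes.
Variable p : nat.
Local Notation G := 'Z_p.+2.

Definition near0 (w : nat) : {set G} :=
  [set (t : nat)%:R | t : 'I_w] :|: [set - (t : nat)%:R | t : 'I_w].

(** The index type is larger than the number of boxes, so the points left over after the last full
    box need no special case. *)
Definition box (L : nat) (y : G) : 'I_p.+2 := inord (y %/ L).

Definition box_interior (N L w : nat) : {set G} :=
  [set (qr.1 * L + w + qr.2)%N%:R | qr : 'I_N * 'I_(L - w.*2)].

Lemma card_near0 (w : nat) : (#|near0 w| <= w.*2)%N.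
Proof.
rewrite (leq_trans (leq_card_setU _ _)) // -addnn leq_add //;
  by rewrite (leq_trans (leq_imset_card _ _)) // card_ord.
Qed.

Lemma near0P (w t : nat) : (t < w)%N -> t%:R \in near0 w /\ - t%:R \in near0 w.
Proof.
move=> tw; rewrite !inE; split; apply/orP; [left|right];
  by apply/imsetP; exists (Ordinal tw).
Qed.

Lemma val_box (L : nat) (y : G) : box L y = (y %/ L)%N :> nat.
Proof. by rewrite inordK // (leq_ltn_trans (leq_div _ _)) // ltn_ord. Qed.

Lemma divn_eq_near0 (L : nat) (y z : G) :
  (0 < L)%N -> (y %/ L = z %/ L)%N -> y - z \in near0 L.
Proof.
move=> L0 yz; rewrite -[y]natr_Zp -[z]natr_Zp.
have lt (a b : nat) : (a %/ L = b %/ L)%N -> (a - b < L)%N.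
  move=> ab; rewrite (divn_eq a L) (divn_eq b L) ab subnDl.
  by rewrite (leq_ltn_trans (leq_subr _ _)) // ltn_mod.
have [zy|/ltnW yz'] := leqP (z : nat) y.
  by rewrite -natrB //; apply: (near0P (lt _ _ yz)).1.
by rewrite -opprB -natrB //; apply: (near0P (lt _ _ (esym yz))).2.
Qed.

Lemma val_natr_Zp (a : nat) : (a < p.+2)%N -> (a%:R : G) = a :> nat.
Proof. by move=> ap; rewrite val_Zp_nat // modn_small. Qed.

Lemma ltn_box (N L q s : nat) :
  (q < N)%N -> (s < L)%N -> (N * L <= p.+2)%N -> (q * L + s < p.+2)%N.
Proof.
move=> qN sL NL; apply: leq_trans NL.
by apply: leq_trans (leq_mul qN (leqnn L)); rewrite mulSn; lia.
Qed.

Lemma box_natr (N L q s : nat) :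
  (q < N)%N -> (s < L)%N -> (N * L <= p.+2)%N -> box L (q * L + s)%N%:R = inord q.
Proof.
move=> qN sL NL; rewrite /box val_natr_Zp; last exact: ltn_box NL.
by rewrite divnMDl 1?(leq_ltn_trans _ sL) // divn_small // addn0.
Qed.

Lemma card_box_interior (N L w : nat) :
  (N * L <= p.+2)%N -> #|box_interior N L w| = (N * (L - w.*2))%N.
Proof.
move=> NL; rewrite card_imset ?card_prod ?card_ord //.
move=> [q r] [q' r'] /= E.
have lt (l : 'I_(L - w.*2)) : (w + l < L)%N by have := ltn_ord l; lia.
move: (congr1 (@nat_of_ord _) E).
rewrite -!addnA !val_natr_Zp ?(ltn_box _ _ NL) //.
move=> E'; have qq : q = q' :> nat.
  have := congr1 (divn^~ L) E'.
  by rewrite !divnMDl ?divn_small ?addn0 // (leq_ltn_trans _ (lt r)).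
congr pair; apply: val_inj => //=.
by move: E'; rewrite qq; lia.
Qed.

Lemma box_interiorD (N L w : nat) (y c : G) :
  (N * L <= p.+2)%N -> y \in box_interior N L w -> c \in near0 w ->
  box L (y + c) = box L y.
Proof.
move=> NL /imsetP[[q r] _ ->] /=; have := ltn_ord r => rL; rewrite -addnA.
rewrite (@box_natr N) //; last by lia.
rewrite inE => /orP[] /imsetP[t _ ->]; have := ltn_ord t => tw.
  by rewrite -natrD -addnA (@box_natr N) //; lia.
have tle : (t <= w + r)%N by lia.
rewrite -natrB; last by rewrite (leq_trans tle) // leq_addl.
by rewrite -addnBA // (@box_natr N) //; lia.
Qed.

(** Record which boxes of length [w] contain the points [u ^+ j * x], [j < k]. There are at most
    [M ^ k] records, and two points with the same record differ by an element of the Bohr set, so a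
    large fibre translates into it. *)
Lemma card_bohr (u : G) (k w M : nat) :
  (0 < w)%N -> (p.+2 %/ w < M)%N ->
  (p.+2 <= M ^ k * #|[set b : G | [forall j : 'I_k, (u ^+ j * b)%R \in near0 w]]|)%N.
Proof.
case: M => // M w0 pM.
pose f (x : G) : {ffun 'I_k -> 'I_M.+1} :=
  [ffun j => inord ((u ^+ (nat_of_ord j) * x)%R %/ w)%N].
have [x] := pigeonhole_fiber f 0.
rewrite card_ffun !card_ord => /leq_trans; apply.
rewrite leq_mul2l; apply/orP; right.
rewrite -(card_imset _ (addIr (- x))); apply: subset_leq_card.
apply/subsetP => _ /imsetP[y + ->]; rewrite !inE => /eqP fyx.
apply/forallP => j; rewrite mulrBr; apply: divn_eq_near0 => //.
have := congr1 (fun g : {ffun 'I_k -> 'I_M.+1} => g j : nat) fyx.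
rewrite /= !ffunE !inordK // (leq_ltn_trans _ pM) // leq_div2r // ltnW //;
  exact: ltn_ord.
Qed.

End CyclicBoxes.

(** * Multipliers of absolute value above 1 *)

Lemma unit_intr_Zp (p : nat) (z : int) :
  prime p.+2 -> (0 < `|z| < p.+2)%N -> (z%:~R : 'Z_p.+2) \is a GRing.unit.
Proof.
move=> pp /andP[z0 zp].
have H : ((`|z|%N)%:R : 'Z_p.+2) \is a GRing.unit.
  by rewrite unitZpE // prime_coprime // gtnNdvd.
have [/gez0_abs <-|/ltW/lez0_abs zE] := leP 0 z; first by rewrite -pmulrn.
by rewrite -unitrN -mulrNz -zE -pmulrn.
Qed.

(** Distinct powers of [z] differ by a nonzero integer, which is a unit modulo every prime above the
    upper bound; this is one reason for taking p large. *)
Lemma absz_subX_bounds (z : int) (i j k : nat) : (1 < `|z|)%N -> (i < j <= k)%N ->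
  (0 < `|z ^+ j - z ^+ i| <= 2 * `|z| ^ k)%N.
Proof.
move=> z1 /andP[ij jk].
have lt : (`|z| ^ i < `|z| ^ j)%N by rewrite ltn_exp2l.
have le : (`|z| ^ j <= `|z| ^ k)%N by rewrite leq_exp2l.
by have := abszX i z; have := abszX j z; lia.
Qed.

Lemma exists_dilate_sumset_avoiding (p n : nat) (lambda : int) :
  prime p -> (1 < `|lambda|)%N -> (0 < n)%N ->
  (1536 * n ^ 5 <= p)%N -> (2 * `|lambda| ^ n.*2.+1 < p)%N ->
  exists A : {set 'Z_p},
    (n.-1 * p <= n.*2.+2 * #|A|)%N /\
    (p <= (3072 * n ^ 5) ^ n.*2.+1 * #|~: sumset A (dilate lambda A)|)%N.
Proof.
case: p => [|[|p]] // pp lam1 n0 Wp lamp.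
(* With about [N] boxes of length [L] and margins [w], each of the two losses in [card_marker_good]
   is at most p/(2n): see [H1], [H5] for the margins and [H2], [H4] for repeated boxes. *)
pose N := (64 * n ^ 3)%N; pose W := (1536 * n ^ 5)%N.
pose L := (p.+2 %/ N)%N; pose w := (p.+2 %/ W)%N.
pose k := n.*2.+1.
have n30 : (0 < n ^ 3)%N by rewrite expn_gt0 n0.
have n53 : (n ^ 3 <= n ^ 5)%N by rewrite leq_pexp2l.
have N0 : (0 < N)%N by rewrite /N; lia.
have W0 : (0 < W)%N by rewrite /W; lia.
have w0 : (0 < w)%N by rewrite divn_gt0.
have L0 : (0 < L)%N by rewrite divn_gt0 //; rewrite /N; lia.
have NL : (N * L <= p.+2)%N by rewrite mulnC leq_trunc_div.
have Ww : (W * w <= p.+2)%N by rewrite mulnC leq_trunc_div.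
have NL' : (p.+2 < N * L + N)%N.
  by have := ltn_ceil p.+2 N0; rewrite -/L mulSn; lia.
have Ww' : (p.+2 < W * w + W)%N.
  by have := ltn_ceil p.+2 W0; rewrite -/w mulSn; lia.
pose u : 'Z_p.+2 := (- lambda)%:~R.
have lamN : (1 < `|- lambda|)%N by rewrite abszN.
have lamle : (`|lambda| <= `|lambda| ^ k)%N.
  by rewrite -[X in (X <= _)%N]expn1 leq_pexp2l //; lia.
have uU : u \is a GRing.unit.
  by apply: unit_intr_Zp => //; rewrite abszN; rewrite -/k in lamp; lia.
have duU i j : (i < j <= k)%N -> u ^+ j - u ^+ i \is a GRing.unit.
  move=> ij; have := absz_subX_bounds lamN ij; rewrite abszN => H.
  rewrite /u -!rmorphXn -rmorphB; apply: unit_intr_Zp => //.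
  by rewrite -/k in lamp; lia.
pose F := box_interior p N L w.
have [s Hs] := exists_large_marker_set n (@box p L) F u.
exists (marker_set k (@box p L) F u s); split.
  apply: leq_trans Hs; rewrite -/k.
  have cellD (y z : 'Z_p.+2) : box L y = box L z -> y - z \in near0 p L.
    move=> /(congr1 (@nat_of_ord _)); rewrite !val_box.
    exact: divn_eq_near0.
  have := card_marker_good F cellD uU duU.
  have cG : #|'Z_p.+2| = p.+2 by exact: card_ord.
  rewrite cG.
  have := cardsC F; rewrite card_box_interior // cG => cF.
  have := card_near0 p L.
  set g := #|marker_good _ _ _ _|; set d := #|near0 _ _|; set f := #|~: F| in cF *.
  move=> dL gp.
  (* Each box loses 2w points, and fewer than [N] points are left over; as [w] is positive, the
     total is at most 3Nw. *)
  have fle : (f <= 192 * n ^ 3 * w)%N.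
    have : (N * L <= N * (L - w.*2) + N * w.*2)%N 
      by rewrite -mulnDr leq_mul2l; lia.
    have : (N <= N * w)%N by rewrite leq_pmulr.
    have : (N * w.*2 = 2 * (N * w))%N by lia.
    have -> : (192 * n ^ 3 * w = 3 * (N * w))%N by rewrite /N !mulnA.
    move: cF NL'; move: (N * L)%N (N * w.*2)%N (N * w)%N (N * _)%N; lia.
  have k4 : (k.+1 <= 4 * n)%N by rewrite /k; lia.
  have H1 : (n * (k.+1 * f) <= 768 * n ^ 5 * w)%N.
    apply: leq_trans (leq_mul (leqnn n) (leq_mul k4 fle)) _.
    by rewrite (_ : (n ^ 5 = n ^ 3 * n * n)%N) -?expnSr //; lia.
  have H2 : (n * (k.+1 ^ 2 * d) <= 32 * n ^ 3 * L)%N.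
    have k42 : (k.+1 ^ 2 <= (4 * n) ^ 2)%N by rewrite leq_exp2r.
    apply: leq_trans (leq_mul (leqnn n) (leq_mul k42 dL)) _.
    have -> : (n ^ 3 = n * n * n)%N by rewrite !expnS expn0 muln1 mulnA.
    by rewrite -mulnn; lia.
  have H3 : (n * p.+2 <= n * g + n * (k.+1 * f) + n * (k.+1 ^ 2 * d))%N.
    by rewrite -!mulnDr leq_mul2l gp orbT.
  have H4 : (2 * (32 * n ^ 3 * L) <= p.+2)%N.
    by rewrite (mulnA 2 _ L) (mulnA 2 32).
  have H5 : (2 * (768 * n ^ 5 * w) <= p.+2)%N.
    by rewrite (mulnA 2 _ w) (mulnA 2 768).
  have : (n.-1 * p.+2 + p.+2 = n * p.+2)%N.
    by rewrite -{2}(prednK n0) mulSn addnC.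
  move: H1 H2 H3 H4 H5; generalize (768 * n ^ 5 * w)%N (32 * n ^ 3 * L)%N.
  generalize (n.-1 * p.+2)%N (n * p.+2)%N (n * g)%N.
  generalize (n * (k.+1 * f))%N (n * (k.+1 ^ 2 * d))%N; clear; lia.
(* The value of [M] is 2W, which exceeds p/w because p < Ww + W and [w] is positive. *)
apply: leq_trans (card_bohr u k w0 (M := 3072 * n ^ 5) _) _.
  rewrite ltn_divLR //; have : (W <= W * w)%N by rewrite leq_pmulr.
  by rewrite /W in Ww' *; lia.
rewrite leq_mul2l; apply/orP; right; apply: subset_leq_card.
apply/subsetP => b; rewrite !inE => /forallP Hb.
apply/negP => /imset2P[a _ aA /imsetP[a' a'A ->] bE].
have Fbox y c := @box_interiorD p N L w y c NL.
have := marker_set_shift Fbox Hb a'A.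
(* If b = a + lambda a', then b + u a' = a, since u = -lambda. *)
suff -> : b + u * a' = a by rewrite aA.
by rewrite bE /u mulrNz mulNr mulrzl addrK.
Qed.

(** * Multipliers 1 and -1 *)

Lemma exists_unit_dilate_sumset (p m : nat) (lambda : int) :
  (1 < p)%N -> (m <= p)%N -> `|lambda|%N = 1%N ->
  exists A : {set 'Z_p},
    #|A| = m /\ (#|sumset A (dilate lambda A)| <= m.*2)%N.
Proof.
case: p => [|[|p]] // _ mp lam1.
pose A : {set 'Z_p.+2} := [set (t : nat)%:R | t : 'I_m].
exists A; split.
  rewrite card_imset ?card_ord // => t t' /(congr1 (@nat_of_ord _)).
  by rewrite !val_natr_Zp ?(leq_trans (ltn_ord _) mp) // => /val_inj.
have [->|->] : lambda = 1 \/ lambda = -1 by lia.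
  pose B : {set 'Z_p.+2} := [set (t : nat)%:R | t : 'I_m.*2].
  apply: (@leq_trans #|B|).
    apply: subset_leq_card; apply/subsetP => z /imset2P[x y].
    case/imsetP=> t _ -> {x} /imsetP[_ /imsetP[t' _ ->] ->] -> {y z}.
    rewrite -natrD.
    have tt : (t + t' < m.*2)%N by have := ltn_ord t; have := ltn_ord t'; lia.
    by apply/imsetP; exists (Ordinal tt).
  by rewrite (leq_trans (leq_imset_card _ _)) // card_ord.
apply: leq_trans (card_near0 p m); apply: subset_leq_card.
apply/subsetP => z /imset2P[x y].
case/imsetP=> t _ -> {x} /imsetP[_ /imsetP[t' _ ->] ->] -> {y z}.
rewrite mulrN1z; apply: divn_eq_near0.
  exact: leq_ltn_trans (leq0n t) (ltn_ord t).
by rewrite !val_natr_Zp ?(leq_trans (ltn_ord _) mp) // !divn_small.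
Qed.

(** * Numerical estimates and conclusion *)

(** Since 3072 is below 3^8, the base is at most n^13, and 13(2n+1) is at most 39n. *)
Lemma leq_avoiding_bound (n : nat) :
  (2 < n)%N -> ((3072 * n ^ 5) ^ n.*2.+1 <= n ^ (39 * n))%N.
Proof.
move=> n2; have n0 : (0 < n)%N by lia.
apply: (@leq_trans ((n ^ 13) ^ n.*2.+1)).
  rewrite leq_exp2r // (_ : 13 = 8 + 5)%N // expnD leq_mul2r.
  by apply/orP; right; apply: (@leq_trans (3 ^ 8)) => //; rewrite leq_exp2r.
by rewrite -expnM leq_pexp2l //; lia.
Qed.

Theorem theorem6 (R : realType) :
  exists C : R,
    forall (eps : R) (lambda : int), 0 < eps -> eps <= 1 -> lambda <> 0 ->
    exists p0 : nat, forall p : nat, prime p -> (p0 <= p)%N ->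
    exists A : {set 'Z_p},
      (2^-1 - eps) * p%:R <= #|A|%:R /\
      #|sumset A (dilate lambda A)|%:R <= (1 - powR eps (C * eps^-1)) * p%:R.
Proof.
(* The proof needs the exponent 78n, and n is at most 1 + 1/eps, hence at most 2/eps. *)
exists 156%:R => eps lambda e0 e1 lam0.
have eV0 : 0 < eps^-1 by rewrite invr_gt0.
have eV1 : 1 <= eps^-1 by rewrite invf_ge1.
have eVK : eps * eps^-1 = 1 by rewrite divff // gt_eqF.
have e01 : 0 < eps <= 1 by rewrite e0.
(* For eps at least 1/2 the empty set suffices. *)
have [e2|e2] := leP 2^-1 eps.
  exists 0%N => p _ _; exists set0; rewrite cards0; split.
    by rewrite mulr_le0_ge0 // subr_le0.
  suff -> : sumset set0 (dilate lambda set0) = set0 :> {set 'Z_p}.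
    rewrite cards0 mulr_ge0 // subr_ge0 -[leRHS](powRr0 eps) ger_powR //.
    by apply: mulr_ge0; [exact: ler0n | exact: ltW].

  by apply/setP => x; rewrite inE; apply/negP => /imset2P[a b]; rewrite inE.
have [lam1|lam1] := eqVneq `|lambda|%N 1%N.
  exists (Num.truncn (2 * eps^-1)).+1 => p pp p0p.
  have ep : 2 <= eps * p%:R.
    have : 2 * eps^-1 < p%:R.
      by apply: lt_le_trans (truncnS_gt _) _; rewrite ler_nat.
    by rewrite -(ltr_pM2l e0) mulrCA eVK mulr1 => /ltW.
  set x := (2^-1 - eps) * p%:R.
  have x0 : 0 <= x by rewrite mulr_ge0 // subr_ge0 ltW.
  (* Rounding up costs at most 2 in [m.*2], which is at most eps p; so 2m is at most (1 - 2 eps) p +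
     2, hence at most (1 - eps) p. *)
  pose m := (Num.truncn x).+1.
  have xm : x < m%:R := truncnS_gt _.
  have mx : m%:R <= x + 1 by rewrite /m -natr1 lerD2r truncn_le.
  have p0 : 0 <= p%:R :> R by [].
  have m2 : m.*2%:R <= (1 - eps) * p%:R :> R.
    by rewrite -mul2n natrM; move: mx ep; rewrite /x; lra.
  have mp : (m <= p)%N.
    have : (m.*2 <= p)%N by rewrite -(ler_nat R); move: m2 ep; lra.
    by lia.
  have [A [cA cS]] := exists_unit_dilate_sumset (prime_gt1 pp) mp lam1.
  exists A; split; first by rewrite cA ltW.
  apply: (@le_trans _ _ m.*2%:R); first by rewrite ler_nat.
  apply: le_trans m2 _; rewrite ler_wpM2r // lerD2l lerN2.
  rewrite -[leRHS](powRr1 (ltW e0)) ger_powR //.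
  by rewrite -[leLHS]mulr1 ler_pM // ler1n.
have lam2 : (1 < `|lambda|)%N by lia.
(* The density obtained is (n-1)/(2n+2) = 1/2 - 1/(n+1), and n > 1/eps makes the loss less than
   eps. *)
pose n := (Num.truncn eps^-1).+1.
have nV : eps^-1 < n%:R := truncnS_gt _.
have nV1 : n%:R <= eps^-1 + 1 by rewrite /n -natr1 lerD2r truncn_le // ltW.
have V2 : 2 < eps^-1 by rewrite -(ltr_pM2l e0) eVK; lra.
have n2 : (2 < n)%N by rewrite -(ltr_nat R); apply: lt_trans V2 nV.
have en : 1 <= eps * n%:R by rewrite -[leLHS]eVK ler_pM2l // ltW.
exists (maxn (1536 * n ^ 5) (2 * `|lambda| ^ n.*2.+1).+1) => p pp.
rewrite geq_max => /andP[Wp lamp].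
have [|A [cA cS]] := exists_dilate_sumset_avoiding pp lam2 _ Wp lamp.
  by lia.
have p0 : 0 < p%:R :> R by rewrite ltr0n prime_gt0.
exists A; split.
  have n20 : 0 < n.*2.+2%:R :> R by rewrite ltr0n.
  rewrite -(ler_pM2l n20).
  have : (n.-1 * p)%N%:R <= (n.*2.+2 * #|A|)%N%:R :> R by rewrite ler_nat.
  rewrite !natrM => /(le_trans _); apply.
  rewrite mulrA ler_pM2r //.
  have -> : n.*2.+2%:R = 2 * n%:R + 2 :> R by rewrite -addn2 -mul2n natrD natrM.
  have -> : n.-1%:R = n%:R - 1 :> R by rewrite -subn1 natrB //; lia.
  by move: en; lra.
set S := sumset _ _ in cS *.
have cSC : #|S|%:R + #|~: S|%:R = p%:R :> R.
  rewrite -natrD cardsC; case: p pp {Wp lamp cA cS p0 A S} => [|[|p]] //= _.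
  by congr _%:R; exact: card_ord.
suff H : powR eps (156%:R * eps^-1) * p%:R <= #|~: S|%:R.
  by rewrite mulrBl mul1r -cSC; move: H; rewrite -cSC; lra.
set q := powR _ _.
have q0 : 0 <= q by apply: powR_ge0.
have qle : q <= eps ^+ (2 * (39 * n)).
  rewrite -(powR_mulrn _ (ltW e0)) ger_powR // natrM natrM; lra.
(* Here [eps ^+ 2 * n] is at most 1, because eps n is at most 2 and eps is below 1/2; one factor
   eps^2 thus pays for each factor n. *)
have qM : q * ((3072 * n ^ 5) ^ n.*2.+1)%N%:R <= 1.
  apply: (@le_trans _ _ (eps ^+ (2 * (39 * n)) * (n ^ (39 * n))%N%:R)).
    by rewrite ler_pM // ler_nat leq_avoiding_bound.
  rewrite natrX exprM -exprMn; apply: exprn_ile1.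
    by rewrite mulr_ge0 ?exprn_ge0 // ltW.
  rewrite expr2 -mulrA.
  have en2 : eps * n%:R <= 2.
    apply: (@le_trans _ _ (eps * (2 * eps^-1))).
      by rewrite ler_pM2l //; move: nV1 eV1; lra.
    by rewrite mulrCA eVK mulr1.
  apply: (@le_trans _ _ (eps * 2)); first by rewrite ler_pM2l.
  by move: e2; lra.
apply: (@le_trans _ _ (q * ((3072 * n ^ 5) ^ n.*2.+1 * #|~: S|)%N%:R)).
  by rewrite ler_wpM2l // ler_nat.
by rewrite natrM mulrA -[leRHS]mul1r ler_wpM2r.
Qed.
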